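(* Let $A\in\mathbb{R}^{n\times n}$ be a nonsingular matrix and denote $\nu=\|A^{-1}\|_2$. Let $\omega\in\mathbb{R}$. If $$0<\nu<1\quad\text{and}\quad 0<\omega<\frac{2-2\sqrt{\nu}}{1-\nu},$$ then for any $b\in\mathbb{R}^n$ the absolute value equation $Ax-|x|=b$ has a unique solution $x_*\in\mathbb{R}^n$, and the sequence $\{(x^{(k)},y^{(k)})\}_{k=0}^\infty$ generated by the SOR-like iteration $$\begin{cases} x^{(k+1)}=(1-\omega)x^{(k)}+\omega A^{-1}(y^{(k)}+b),\\ y^{(k+1)}=(1-\omega)y^{(k)}+\omega|x^{(k+1)}|,\end{cases}\qquad k=0,1,2,\ldots$$ converges globally linearly to $(x_*,y_* )$ with $y_*=|x_*|$.
   Context: For a vector $x\in\mathbb{R}^n$, $|x|\in\mathbb{R}^n$ denotes the entrywise absolute value. $\|\cdot\|_2$ denotes the Euclidean norm of vectors and the induced operator norm (spectral norm) of matrices. ''Globally'' means for arbitrary initial vectors $x^{(0)},y^{(0)}\in\mathbb{R}^n$. ''Linearly'' means that the errors decay at least geometrically: for each choice of initial vectors there are constants $C\ge 0$ and $q\in(0,1)$ such that $\|x^{(k)}-x_*\|_2\le Cq^k$ and $\|y^{(k)}-y_*\|_2\le Cq^k$ for all $k\ge 0$. *)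

(* Defs.v *)
From HB Require Import structures.
From mathcomp Require Import all_boot all_order all_algebra.
From mathcomp Require Import classical_sets reals.

Set Implicit Arguments.
Unset Strict Implicit.
Unset Printing Implicit Defensive.

Import Order.TTheory GRing.Theory Num.Theory.
Local Open Scope classical_set_scope.
Local Open Scope ring_scope.

(* The norm that MathComp-Analysis puts on matrices is the max norm, so the
   Euclidean norm, the induced operator norm and the entrywise absolute value
   are defined here under their own names. *)

Definition norm2 (R : realType) (n : nat) (x : 'cV[R]_n) : R :=
  Num.sqrt (\sum_(i < n) x i 0 ^+ 2).

Definition opnorm2 (R : realType) (m n : nat) (M : 'M[R]_(m, n)) : R :=
  sup [set norm2 (M *m x) | x in [set x : 'cV[R]_n | norm2 x <= 1]].

Definition absv (R : realType) (n : nat) (x : 'cV[R]_n) : 'cV[R]_n :=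
  map_mx Num.norm x.

Definition ave_solution (R : realType) (n : nat) (A : 'M[R]_n) (b x : 'cV[R]_n)
  : Prop := A *m x - absv x = b.

(* The update of y uses the already updated x (Gauss-Seidel order).  The
   initial vectors x 0 and y 0 are unconstrained. *)
Definition sor_like_sequence (R : realType) (n : nat) (A : 'M[R]_n)
    (b : 'cV[R]_n) (omega : R) (x y : nat -> 'cV[R]_n) : Prop :=
  forall k : nat,
    x k.+1 = (1 - omega) *: x k + omega *: (invmx A *m (y k + b)) /\
    y k.+1 = (1 - omega) *: y k + omega *: absv (x k.+1).

Definition pair_converges_linearly (R : realType) (n : nat)
    (x y : nat -> 'cV[R]_n) (xs ys : 'cV[R]_n) : Prop :=
  exists C q : R, [/\ 0 <= C, 0 < q < 1 &
    forall k : nat, norm2 (x k - xs) <= C * q ^+ k /\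
                    norm2 (y k - ys) <= C * q ^+ k].

(* Main.v *)
Require Import Defs.
From HB Require Import structures.
From mathcomp Require Import all_boot all_order all_algebra.
From mathcomp Require Import ring lra.
From mathcomp Require Import classical_sets functions reals interval_inference.
From mathcomp Require Import topology normedtype sequences.

(** Write [nu] for the spectral norm of [A^-1], [s] for [|1 - omega|] and [r]
for the square root of [nu].

The equation [A x - |x| = b] says that [x] is a fixed point of
[x |-> A^-1 (|x| + b)].  Taking entrywise absolute values is nonexpansive for
the Euclidean norm, so this map is a [nu]-contraction and has exactly one fixed
point [xs] ([contraction2_fixpoint]).

The pair [(xs, |xs|)] is stationary for the iteration, and subtracting it from
the two update rules bounds the errors [a k = ||x k - xs||] and
[c k = ||y k - |xs| ||] by
   [a k.+1 <= s * a k + omega * nu * c k]  and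
   [c k.+1 <= s * c k + omega * a k.+1].
Measuring the second error by [r * c k] makes the coupling symmetric: with
[tau = omega * r] the two bounds become
   [a k.+1 <= s * a k + tau * (r * c k)]  and
   [r * c k.+1 <= s * (r * c k) + tau * a k.+1].
Hence if [a k] and [r * c k] are both at most [m] and [s + tau <= 1], then
[a k.+1 <= (s + tau) * m <= m], and this last bound fed into the second line
yields [r * c k.+1 <= (s + tau) * m]: the larger of the two weighted errors
shrinks by [s + tau] at each step ([weighted_errors_decay]).  Since
[1 - nu = (1 - r) * (1 + r)], the bound imposed on [omega] is
[omega < 2 / (1 + r)], which makes [s + tau < 1] ([relaxation_rate_lt1]). *)

Set Implicit Arguments.
Unset Strict Implicit.

Import Order.TTheory GRing.Theory Num.Theory.
Import numFieldNormedType.Exports.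
Local Open Scope ring_scope.

(** * Euclidean norm *)

Lemma norm2_ge0 (R : realType) n (x : 'cV[R]_n) : 0 <= norm2 x.
Proof. exact: sqrtr_ge0. Qed.

Lemma sum_sqr_ge0 (R : realType) n (x : 'I_n -> R) : 0 <= \sum_i x i ^+ 2.
Proof. by apply: sumr_ge0 => i _; apply: sqr_ge0. Qed.

Lemma sqr_norm2 (R : realType) n (x : 'cV[R]_n) :
  norm2 x ^+ 2 = \sum_i x i 0 ^+ 2.
Proof. by rewrite sqr_sqrtr ?sum_sqr_ge0. Qed.

Lemma le_norm2 (R : realType) n (x y : 'cV[R]_n) :
  (forall i, `|x i 0| <= `|y i 0|) -> norm2 x <= norm2 y.
Proof.
move=> le_xy; rewrite ler_wsqrtr //; apply: ler_sum => i _.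
by rewrite -(real_normK (num_real (x i 0))) -(real_normK (num_real (y i 0)))
  lerXn2r ?nnegrE.
Qed.

Lemma norm2Z (R : realType) n (a : R) (x : 'cV[R]_n) :
  norm2 (a *: x) = `|a| * norm2 x.
Proof.
rewrite /norm2 -sqrtr_sqr -sqrtrM ?sqr_ge0 // mulr_sumr.
by congr Num.sqrt; apply: eq_bigr => i _; rewrite mxE exprMn.
Qed.

Lemma norm2_0 (R : realType) n : norm2 (0 : 'cV[R]_n) = 0.
Proof. by rewrite -(scale0r 0) norm2Z normr0 mul0r. Qed.

Lemma norm_coord_le_norm2 (R : realType) n (x : 'cV[R]_n) i :
  `|x i 0| <= norm2 x.
Proof.
rewrite -sqrtr_sqr ler_wsqrtr // (bigD1 i) //= lerDl.
by apply: sumr_ge0 => j _; apply: sqr_ge0.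
Qed.

Lemma norm2_eq0 (R : realType) n (x : 'cV[R]_n) : norm2 x <= 0 -> x = 0.
Proof.
move=> x0; apply/matrixP => i j; rewrite (ord1 j) mxE; apply/eqP.
by rewrite -normr_le0 (le_trans (norm_coord_le_norm2 _ _)).
Qed.

Lemma Cauchy_Schwarz_sum (R : realType) n (x y : 'I_n -> R) :
  (\sum_i x i * y i) ^+ 2 <= (\sum_i x i ^+ 2) * (\sum_i y i ^+ 2).
Proof.
set P := \sum_i x i * y i; set X := \sum_i x i ^+ 2.
set Y := \sum_i y i ^+ 2.
have : 0 <= X * (X * Y - P ^+ 2).
  (* the squared length of the residual of y after projection on x, scaled *)
  have -> : X * (X * Y - P ^+ 2) = \sum_i (X * y i - P * x i) ^+ 2.
    have expand i : (X * y i - P * x i) ^+ 2 =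
        X ^+ 2 * y i ^+ 2 + (- 2 * X * P) * (x i * y i) + P ^+ 2 * x i ^+ 2.
      by ring.
    rewrite (eq_bigr _ (fun i _ => expand i)) !big_split /=.
    rewrite -!mulr_sumr -/X -/Y -/P.
    by ring.
  exact: sum_sqr_ge0.
have [X0|Xgt0] := leP X 0; last by rewrite pmulr_rge0 // subr_ge0.
have x0 i : x i = 0.
  apply/eqP; rewrite -sqrf_eq0 eq_le sqr_ge0 andbT (le_trans _ X0) //.
  by rewrite /X (bigD1 i) //= lerDl sumr_ge0 // => j _; apply: sqr_ge0.
move=> _; rewrite /P big1 => [|i _]; last by rewrite x0 mul0r.
by rewrite expr0n /= mulr_ge0 ?sum_sqr_ge0.
Qed.

Lemma ler_norm2D (R : realType) n (x y : 'cV[R]_n) :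
  norm2 (x + y) <= norm2 x + norm2 y.
Proof.
rewrite -(@ler_pXn2r _ 2) ?nnegrE ?addr_ge0 ?norm2_ge0 //.
rewrite sqrrD !sqr_norm2.
have -> : \sum_i (x + y) i 0 ^+ 2 =
    \sum_i x i 0 ^+ 2 + (\sum_i x i 0 * y i 0) *+ 2 + \sum_i y i 0 ^+ 2.
  by rewrite -sumrMnl -!big_split; apply: eq_bigr => i _; rewrite mxE sqrrD.
rewrite lerD2r lerD2l lerMn2r /=; apply: le_trans (ler_norm _) _.
rewrite -(@ler_pXn2r _ 2) ?nnegrE ?mulr_ge0 ?norm2_ge0 //.
rewrite real_normK ?num_real // exprMn !sqr_norm2.
exact: (Cauchy_Schwarz_sum (fun i => x i 0) (fun i => y i 0)).
Qed.

Lemma norm2_absv_sub (R : realType) n (x y : 'cV[R]_n) :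
  norm2 (absv x - absv y) <= norm2 (x - y).
Proof. by apply: le_norm2 => i; rewrite !mxE ler_dist_dist. Qed.

(** * Spectral norm *)

(** The Frobenius norm bounds the set whose supremum defines [opnorm2], without
which that supremum would carry no information. *)
Lemma norm2_mulmx_Frobenius (R : realType) m n (M : 'M[R]_(m, n))
    (x : 'cV[R]_n) :
  norm2 (M *m x) <= Num.sqrt (\sum_i \sum_j M i j ^+ 2) * norm2 x.
Proof.
have F0 : 0 <= \sum_i \sum_j M i j ^+ 2.
  by apply: sumr_ge0 => i _; apply: sum_sqr_ge0.
rewrite /norm2 -sqrtrM // ler_wsqrtr // mulr_suml; apply: ler_sum => i _.
by rewrite mxE; apply: (Cauchy_Schwarz_sum (M i) (fun j => x j 0)).
Qed.

Lemma norm2_mulmx_le (R : realType) m n (M : 'M[R]_(m, n)) (x : 'cV[R]_n) :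
  norm2 (M *m x) <= opnorm2 M * norm2 x.
Proof.
have [x0|x_gt0] := leP (norm2 x) 0.
  by rewrite (norm2_eq0 x0) mulmx0 !norm2_0 mulr0.
have bounded : has_ubound
    [set norm2 (M *m z) | z in [set z : 'cV[R]_n | norm2 z <= 1]].
  exists (Num.sqrt (\sum_i \sum_j M i j ^+ 2)) => _ [z /= z1 <-].
  apply: le_trans (norm2_mulmx_Frobenius _ _) _.
  by rewrite ler_piMr // sqrtr_ge0.
have norm_inv : `|(norm2 x)^-1| = (norm2 x)^-1.
  by rewrite ger0_norm ?invr_ge0 ?norm2_ge0.
rewrite -ler_pdivrMr // mulrC -norm_inv -norm2Z scalemxAr.
apply: (ub_le_sup bounded); exists ((norm2 x)^-1 *: x) => //=.
by rewrite norm2Z norm_inv mulVf // gt_eqF.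
Qed.

(** * Fixed points of Euclidean contractions *)

(* joins the completeness of matrices with their max norm *)
HB.instance Definition _ (R : realType) m n := Complete.on 'M[R]_(m, n).

Lemma mx_norm_le_norm2 (R : realType) n (x : 'cV[R]_n) : `|x| <= norm2 x.
Proof.
rewrite [leLHS]/Num.Def.normr /= mx_normrE; apply: bigmax_le => [|[i j] _] /=.
  exact: norm2_ge0.
by rewrite (ord1 j) norm_coord_le_norm2.
Qed.

Lemma norm2_le_mx_norm (R : realType) n (x : 'cV[R]_n) :
  norm2 x <= Num.sqrt n%:R * `|x|.
Proof.
rewrite /norm2 -[`|x|]ger0_norm // -sqrtr_sqr -sqrtrM ?ler0n // ler_wsqrtr //.
rewrite mulr_natl -[leRHS](_ : \sum_(i < n) `|x| ^+ 2 = _); last first.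
  by rewrite sumr_const card_ord.
apply: ler_sum => i _; rewrite -[leLHS]real_normK ?num_real //.
rewrite lerXn2r ?nnegrE // [leRHS]/Num.Def.normr /= mx_normrE.
exact: (le_bigmax _ _ (i, 0)).
Qed.

(** Banach's theorem is applied for the max norm, in which a Euclidean
contraction may expand distances.  The two norms being equivalent,
a high enough iterate contracts the max norm as well and has a fixed point [p].
Then [f p] is fixed by the same iterate, which also contracts the Euclidean
norm and so cannot fix two distinct points. *)
Lemma contraction2_fixpoint (R : realType) n (f : 'cV[R]_n -> 'cV[R]_n)
    (q : R) :
  0 <= q < 1 -> (forall x y, norm2 (f x - f y) <= q * norm2 (x - y)) ->
  exists p, f p = p.
Proof.
move=> /andP[q0 q1] f_contr.
have iter_contr k x y :
    norm2 (iter k f x - iter k f y) <= q ^+ k * norm2 (x - y).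
  elim: k => [|k IHk] /=; first by rewrite mul1r.
  by rewrite exprS -mulrA (le_trans (f_contr _ _)) // ler_wpM2l.
have sqrtn_gt0 : 0 < Num.sqrt n%:R + 1 :> R by rewrite ltr_wpDl ?sqrtr_ge0.
(* the extra 1 lets a single bound make both sqrt n * q ^ N and q ^ N small *)
have [N contrN] : exists N, (Num.sqrt n%:R + 1) * q ^+ N < 1.
  have abs_q1 : `|q| < 1 by rewrite ger0_norm.
  have eps_gt0 : 0 < (Num.sqrt n%:R + 1)^-1 :> R by rewrite invr_gt0.
  have [N] := filter_ex (cvgr0_norm_lt _ (cvg_expr abs_q1) _ eps_gt0).
  rewrite ger0_norm ?exprn_ge0 // -[X in _ < X]mul1r ltr_pdivlMr // mulrC => qN.
  by exists N.
have qN0 : 0 <= q ^+ N by rewrite exprn_ge0.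
have sqrtn0 : 0 <= Num.sqrt n%:R :> R by rewrite sqrtr_ge0.
have [|||p _ fix_p] := @banach_fixed_point R 'cV[R]_n setT
    (totalfun (iter N f)).
- exists (NngNum (mulr_ge0 sqrtn0 qN0)); split=> /= [|[x y] _ /=]; first by nra.
  apply: le_trans (mx_norm_le_norm2 _) _; apply: le_trans (iter_contr _ _ _) _.
  by rewrite [_ * q ^+ N]mulrC -mulrA ler_wpM2l // norm2_le_mx_norm.
- exact: closedT.
- by exists 0.
exists p; apply/eqP; rewrite -subr_eq0; apply/eqP/norm2_eq0.
have iter_p : iter N f p = p by rewrite [RHS]fix_p.
have iter_fp : iter N f (f p) = f p by rewrite -iterSr iterS iter_p.
have := iter_contr N (f p) p; rewrite iter_fp iter_p.
have := norm2_ge0 (f p - p); nra.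
Qed.

(** * Decay of the coupled errors *)

(** For [omega <= 1] the left-hand side is [1 - omega * (1 - sqrt nu)], so only
[nu < 1] matters; for [omega > 1] it is [omega * (1 + sqrt nu) - 1], and the
upper bound on [omega] is exactly what keeps it below [1]. *)
Lemma relaxation_rate_lt1 (R : realType) (omega nu : R) :
  0 < nu < 1 -> 0 < omega < (2 - 2 * Num.sqrt nu) / (1 - nu) ->
  `|1 - omega| + omega * Num.sqrt nu < 1.
Proof.
move=> /andP[nu0 nu1] /andP[omega0].
set r := Num.sqrt nu.
have r0 : 0 < r by rewrite sqrtr_gt0.
have nuE : nu = r ^+ 2 by rewrite sqr_sqrtr // ltW.
have r1 : r < 1 by rewrite nuE in nu1; nra.
rewrite ltr_pdivlMr ?subr_gt0 // nuE => omega_lt.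
have {}omega_lt : omega * (1 + r) < 2 by nra.
by case: (ler0P (1 - omega)) => _; nra.
Qed.

(** The second recursion uses the already updated [a k.+1]; as [s + tau <= 1],
[a k.+1] still obeys the common bound on [a k] and [c k], so the factor
[s + tau] comes out for [c] as well. *)
Lemma weighted_errors_decay (R : realType) (a c : nat -> R) (s tau : R) :
  0 <= s -> 0 <= tau -> s + tau <= 1 -> (forall k, 0 <= a k) ->
  (forall k, 0 <= c k) ->
  (forall k, a k.+1 <= s * a k + tau * c k) ->
  (forall k, c k.+1 <= s * c k + tau * a k.+1) ->
  forall k, a k <= (a 0 + c 0) * (s + tau) ^+ k /\
            c k <= (a 0 + c 0) * (s + tau) ^+ k.
Proof.
move=> s0 tau0 q1 a0 c0 stepa stepc; elim=> [|k [IHa IHc]].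
  by rewrite mulr1 lerDl lerDr.
set m := _ * _ ^+ k in IHa IHc.
have m0 : 0 <= m := le_trans (a0 k) IHa.
have -> : (a 0 + c 0) * (s + tau) ^+ k.+1 = (s + tau) * m.
  by rewrite /m exprS; ring.
have ale : a k.+1 <= (s + tau) * m.
  by apply: le_trans (stepa k) _; rewrite mulrDl lerD ?ler_wpM2l.
split=> //; apply: le_trans (stepc k) _; rewrite mulrDl lerD ?ler_wpM2l //.
by apply: le_trans ale _; rewrite ler_piMl.
Qed.

(** * Convergence of the SOR-like iteration *)

Unset Implicit Arguments.
Set Strict Implicit.

Theorem theorem3p1 (R : realType) (n : nat) (A : 'M[R]_n) (omega nu : R)
    (hA : A \in unitmx) (hnu : nu = opnorm2 (invmx A))
    (hnu01 : 0 < nu < 1)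
    (homega : 0 < omega < (2 - 2 * Num.sqrt nu) / (1 - nu))
    (b : 'cV[R]_n) :
  exists xs : 'cV[R]_n,
    unique (ave_solution A b) xs /\
    forall x y : nat -> 'cV[R]_n,
      sor_like_sequence A b omega x y ->
      pair_converges_linearly x y xs (absv xs).
Proof.
have [/andP[nu0 nu1] /andP[omega0 _]] := (hnu01, homega).
have invA_le (z : 'cV[R]_n) : norm2 (invmx A *m z) <= nu * norm2 z.
  by rewrite hnu norm2_mulmx_le.
pose f x : 'cV[R]_n := invmx A *m (absv x + b).
have f_contr x y : norm2 (f x - f y) <= nu * norm2 (x - y).
  rewrite -mulmxBr [absv y + b]addrC addrKA; apply: le_trans (invA_le _) _.
  by rewrite ler_pM2l // norm2_absv_sub.
have solE x : ave_solution A b x <-> f x = x.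
  rewrite /ave_solution /f; split=> [<-|].
    by rewrite addrC subrK mulKmx.
  by move=> {1}<-; rewrite mulKVmx // addrC addrA addNr add0r.
have [|xs xs_fix] := contraction2_fixpoint _ f_contr.
  by rewrite ltW.
exists xs; split.
  split=> [|x /solE x_fix]; first exact/solE.
  apply/eqP; rewrite -subr_eq0; apply/eqP/norm2_eq0.
  have := f_contr xs x; rewrite xs_fix x_fix; have := norm2_ge0 (xs - x).
  nra.
move=> x y sor.
set s := `|1 - omega|; set r := Num.sqrt nu.
have r0 : 0 < r by rewrite sqrtr_gt0.
have rr : r * r = nu by rewrite -expr2 sqr_sqrtr // ltW.
have tau0 : 0 < omega * r by rewrite mulr_gt0.
have q1 : s + omega * r < 1 by apply: relaxation_rate_lt1.
pose a k := norm2 (x k - xs); pose c k := r * norm2 (y k - absv xs).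
have a0 k : 0 <= a k by rewrite norm2_ge0.
have c0 k : 0 <= c k by rewrite mulr_ge0 ?norm2_ge0 // ltW.
have stepa k : a k.+1 <= s * a k + omega * r * c k.
  rewrite /a /c (sor k).1.
  have -> : (1 - omega) *: x k + omega *: (invmx A *m (y k + b)) - xs =
      (1 - omega) *: (x k - xs) + omega *: (invmx A *m (y k - absv xs)).
    have -> : invmx A *m (y k - absv xs) = invmx A *m (y k + b) - xs.
      by rewrite -[in RHS]xs_fix /f -mulmxBr [absv xs + b]addrC addrKA.
    by apply/matrixP => i j; rewrite !mxE; ring.
  apply: le_trans (ler_norm2D _ _) _.
  rewrite !norm2Z (gtr0_norm omega0) lerD2l -mulrA ler_pM2l //.
  by rewrite mulrA rr.
have stepc k : c k.+1 <= s * c k + omega * r * a k.+1.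
  rewrite /a /c (sor k).2.
  have -> : (1 - omega) *: y k + omega *: absv (x k.+1) - absv xs =
      (1 - omega) *: (y k - absv xs) + omega *: (absv (x k.+1) - absv xs).
    by apply/matrixP => i j; rewrite !mxE; ring.
  rewrite mulrCA -mulrA -[omega * _]mulrCA -mulrDr ler_pM2l //.
  apply: le_trans (ler_norm2D _ _) _.
  rewrite !norm2Z (gtr0_norm omega0) lerD2l ler_pM2l //.
  exact: norm2_absv_sub.
have decay := weighted_errors_decay (normr_ge0 _) (ltW tau0) (ltW q1)
  a0 c0 stepa stepc.
have M0 : 0 <= a 0 + c 0 by rewrite addr_ge0.
exists ((a 0 + c 0) * (1 + r^-1)), (s + omega * r); split.
- by rewrite mulr_ge0 ?addr_ge0 ?invr_ge0 // ltW.
- by rewrite q1 andbT ltr_wpDl ?normr_ge0.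
- move=> k; have [adec cdec] := decay k.
  have q_ge0 : 0 <= (s + omega * r) ^+ k.
    by rewrite exprn_ge0 // addr_ge0 ?normr_ge0 // ltW.
  have rV0 : 0 < r^-1 by rewrite invr_gt0.
  split.
    apply: le_trans adec _; rewrite ler_wpM2r // ler_peMr //.
    by rewrite lerDl ltW.
  (* the bound on c k controls r times the error in y, hence the factor 1 / r *)
  have -> : norm2 (y k - absv xs) = r^-1 * c k by rewrite /c mulKf ?gt_eqF.
  rewrite mulrDr mulr1 mulrDl.
  apply: (@le_trans _ _ ((a 0 + c 0) * r^-1 * (s + omega * r) ^+ k)).
    by rewrite [_ * r^-1]mulrC -mulrA ler_pM2l.
  by rewrite lerDr mulr_ge0.
Qed.
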